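(* Let $\mathcal{M}_1=(V,\mathcal{I}_1),\dots,\mathcal{M}_k=(V,\mathcal{I}_k)$ be $k$ matroids on a common ground set $V$ with $|V|=n$, each accessible only through a rank oracle, and let $p$ be the maximum cardinality of a partitionable set. For any $\epsilon>0$, there is an algorithm that uses $O\big((n+k)\epsilon^{-1}\log n\big)$ rank oracle queries and finds a partitionable set of cardinality at least $(1-\epsilon)p$.
   Context: A set $S\subseteq V$ is partitionable if there is a partition $(S_1,\dots,S_k)$ of $S$ with $S_i\in\mathcal{I}_i$ for all $i\in[k]$. A rank oracle for $\mathcal{M}_i$ takes $X\subseteq V$ and returns $\mathrm{rank}_{\mathcal{M}_i}(X)=\max\{|Y|: Y\subseteq X, Y\in\mathcal{I}_i\}$; the query complexity counts the total number of oracle calls over all $k$ matroids. *)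

(* Defs.v *)
From mathcomp Require Import all_boot.

Set Implicit Arguments.
Unset Strict Implicit.
Unset Printing Implicit Defensive.

Record matroid (V : finType) := Matroid {
  indep : {set {set V}};
  indep_set0 : set0 \in indep;
  indep_subset : forall A B : {set V},
    A \subset B -> B \in indep -> A \in indep;
  indep_augment : forall A B : {set V},
    A \in indep -> B \in indep -> #|A| < #|B| ->
    exists2 x, x \in B :\: A & x |: A \in indep
}.

Definition rank (V : finType) (M : matroid V) (X : {set V}) : nat :=
  \max_(Y : {set V} | (Y \subset X) && (Y \in indep M)) #|Y|.

(* The parts of the partition (P 0, ..., P (k-1)) of S are indexed by the
   matroids, and some of them may be empty. *)
Definition partitionable (V : finType) (k : nat) (M : 'I_k -> matroid V)
    (S : {set V}) : bool :=
  [exists P : {ffun 'I_k -> {set V}},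
    [&& [forall i, P i \in indep (M i)],
        [forall i, forall j, (i != j) ==> [disjoint P i & P j]]
      & \bigcup_i P i == S]].

Definition max_partitionable (V : finType) (k : nat)
    (M : 'I_k -> matroid V) : nat :=
  \max_(S : {set V} | partitionable M S) #|S|.

(* Deterministic adaptive algorithms: [Query i X next] asks the i-th oracle
   about X and continues with [next r], where r is the answer.  The matroids do
   not occur in the type, so an algorithm depends on them only through the
   answers it receives. *)
Inductive oracle_alg (V : finType) (k : nat) (A : Type) : Type :=
| Return (a : A)
| Query (i : 'I_k) (X : {set V}) (next : nat -> oracle_alg V k A).

Fixpoint output (V : finType) (k : nat) (A : Type)
    (oracle : 'I_k -> {set V} -> nat) (t : oracle_alg V k A) : A :=
  match t with
  | Return a => a
  | Query i X next => output oracle (next (oracle i X))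
  end.

(* Repeated queries are counted with multiplicity, over all k oracles. *)
Fixpoint query_count (V : finType) (k : nat) (A : Type)
    (oracle : 'I_k -> {set V} -> nat) (t : oracle_alg V k A) : nat :=
  match t with
  | Return _ => 0
  | Query i X next => (query_count oracle (next (oracle i X))).+1
  end.

Definition rank_oracle (V : finType) (k : nat) (M : 'I_k -> matroid V)
    (i : 'I_k) (X : {set V}) : nat := rank (M i) X.

(* Main.v *)
(** Kelso-Crawford ascending auction.  Every element carries an integer level,
    initially 0, and matroid [i] holds a set [S_i].  Repeatedly some matroid [i]
    takes, possibly from another matroid, an element of least level < L outside
    the span of [S_i], and the level of that element goes up by 1.  There are at
    most n L takes, and one take is a binary search for the first prefix of [V],
    sorted by level, that raises the rank of [S_i].

    Matroid [i] sees the prices [level v] for [v] in [S_i] and [level v + 1]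
    otherwise.  Throughout, [S_i] extends to a cheapest basis for these prices,
    so that at the end [S_i] maximizes the sum of [L - price] over the
    independent sets of [M_i].  Compare [S_i] with the [i]-th part of an optimal
    solution [O] and sum over [i]: since elements that are not held have level 0,
    the levels cancel and L |O| <= L |S| + |O|.  Take L about 1 / eps. *)
Require Import Defs.
From mathcomp Require Import all_boot all_order all_algebra.
From mathcomp Require Import reals exp.
From mathcomp Require Import zify ring lra.

Set Implicit Arguments.
Unset Strict Implicit.
Unset Printing Implicit Defensive.

(** * Matroid rank: extension to bases, submodularity, contraction *)

Section Rank.
Variables (V : finType) (M : matroid V).
Implicit Types A B I J X Y T : {set V}.

Lemma leq_rank I X : I \subset X -> I \in indep M -> #|I| <= rank M X.
Proof. by move=> sIX Ii; apply: (leq_bigmax_cond I); rewrite sIX Ii. Qed.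

Lemma rank_leq_card X : rank M X <= #|X|.
Proof. by apply/bigmax_leqP => Y /andP[/subset_leq_card]. Qed.

Lemma rankS X Y : X \subset Y -> rank M X <= rank M Y.
Proof.
move=> sXY; apply/bigmax_leqP => I /andP[sIX Ii].
exact: leq_rank (subset_trans sIX sXY) Ii.
Qed.

Lemma rank_witness X :
  exists I, [/\ I \subset X, I \in indep M & #|I| = rank M X].
Proof.
have P0 : (set0 \subset X) && (set0 \in indep M).
  by rewrite sub0set indep_set0.
rewrite /rank (bigmax_eq_arg set0) //; case: arg_maxnP => // I /andP[sIX Ii] _.
by exists I; split.
Qed.

Lemma indep_rank I : rank M I = #|I| -> I \in indep M.
Proof.
have [J [sJI Ji <-]] := rank_witness I => cJ.
by have /eqP <- : J == I by rewrite eqEcard sJI cJ leqnn.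
Qed.

Lemma indep_extend I X : I \subset X -> I \in indep M ->
  exists J, [/\ I \subset J, J \subset X, J \in indep M & #|J| = rank M X].
Proof.
move: {2}(rank M X - #|I|) (leqnn (rank M X - #|I|)) => d.
elim: d I => [|d IHd] I le_d sIX Ii.
  by exists I; split => //; have := leq_rank sIX Ii; lia.
have [ltI|leI] := ltnP #|I| (rank M X); last first.
  by exists I; split => //; have := leq_rank sIX Ii; lia.
have [K [sKX Ki cK]] := rank_witness X.
rewrite -cK in ltI; have [x xKI xIi] := indep_augment Ii Ki ltI.
move: xKI; rewrite inE => /andP[xI xK].
have [||//|J [sJ sJX Ji cJ]] := IHd (x |: I).
- by rewrite cardsU1 xI; lia.
- by rewrite subUset sub1set (subsetP sKX) // sIX.
by exists J; split => //; apply: subset_trans sJ; apply: subsetUr.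
Qed.

(** A basis of [A :&: B] extends to a basis [J] of [A :|: B], and the traces of [J] on [A] and on
    [B] are independent. *)
Lemma rank_submod A B :
  rank M (A :|: B) + rank M (A :&: B) <= rank M A + rank M B.
Proof.
have [I [sI Ii cI]] := rank_witness (A :&: B).
have sIU : I \subset A :|: B.
  exact: subset_trans sI (subset_trans (subsetIl A B) (subsetUl A B)).
have [J [sIJ sJ Ji <-]] := indep_extend sIU Ii.
have hA : #|J :&: A| <= rank M A.
  by apply: leq_rank (subsetIr _ _) _; apply: indep_subset Ji; apply: subsetIl.
have hB : #|J :&: B| <= rank M B.
  by apply: leq_rank (subsetIr _ _) _; apply: indep_subset Ji; apply: subsetIl.
have hI : #|I| <= #|(J :&: A) :&: (J :&: B)|.
  by apply: subset_leq_card; rewrite -setIIr subsetI sIJ sI.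
have := cardsUI (J :&: A) (J :&: B).
rewrite -setIUr (setIidPl sJ) -cI; lia.
Qed.

Lemma rankU_leq X T : rank M (X :|: T) <= rank M X + #|T|.
Proof. by have := rank_submod X T; have := rank_leq_card T; lia. Qed.

(** This is independence of [T] in the contraction of [M] by [X]; it forces [T] to be disjoint from
    [X]. *)
Definition free_over X T := rank M (X :|: T) == rank M X + #|T|.

(** Each element dropped from [T] costs at most one unit of rank, and by submodularity what [T']
    adds can only grow when [X] shrinks. *)
Lemma free_overS X X' T T' :
  X' \subset X -> T' \subset T -> free_over X T -> free_over X' T'.
Proof.
move=> sX sT /eqP fT; apply/eqP.
have le1 : rank M (X :|: T) <= rank M (X :|: T') + #|T :\: T'|.
  by rewrite -[in X in X <= _](setID T T') (setIidPr sT) setUA rankU_leq.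
have cT := cardsID T' T; rewrite (setIidPr sT) in cT.
have le2 := rank_submod X (X' :|: T').
rewrite setUA (setUidPl sX) in le2.
have le3 : rank M X' <= rank M (X :&: (X' :|: T')).
  by apply: rankS; rewrite subsetI sX subsetUl.
have := rankU_leq X' T'; lia.
Qed.

End Rank.

(** * Query algorithms: sequencing and binary search *)

Section Oracle.
Variables (V : finType) (k : nat).

Fixpoint bind A B (t : oracle_alg V k A) (f : A -> oracle_alg V k B) :
    oracle_alg V k B :=
  match t with
  | Return a => f a
  | Query i X next => Query i X (fun r => bind (next r) f)
  end.

Lemma output_bind A B o (t : oracle_alg V k A) (f : A -> oracle_alg V k B) :
  output o (bind t f) = output o (f (output o t)).
Proof. by elim: t => //= i X next ->. Qed.

Lemma query_count_bind A B o (t : oracle_alg V k A)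
    (f : A -> oracle_alg V k B) :
  query_count o (bind t f)
    = query_count o t + query_count o (f (output o t)).
Proof. by elim: t => //= i X next ->. Qed.

(** [lo] and [hi] are lengths of prefixes of [s]. The set [B] will be independent, so an answer
    above [#|B|] means that the prefix raises its rank. *)
Fixpoint bisect (i : 'I_k) (B : {set V}) (s : seq V) fuel lo hi :
    oracle_alg V k nat :=
  if fuel is fuel'.+1 then
    let mid := (lo + hi) %/ 2 in
    Query i (B :|: [set x in take mid s]) (fun r =>
      if #|B| < r then bisect i B s fuel' lo mid
      else bisect i B s fuel' mid hi)
  else Return V k lo.

Lemma query_count_bisect o i B s fuel lo hi :
  query_count o (bisect i B s fuel lo hi) = fuel.
Proof. by elim: fuel lo hi => //= fuel IH lo hi; case: ifP; rewrite IH. Qed.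

(** Halving keeps a left end that does not raise and a right end that does, until the gap is exactly
    1; the oracle may be arbitrary. *)
Lemma bisectP (o : 'I_k -> {set V} -> nat) i (B : {set V}) s fuel lo hi :
  let raised m := #|B| < o i (B :|: [set x in take m s]) in
  ~~ raised lo -> raised hi -> lo <= hi <= lo + 2 ^ fuel ->
  let m := output o (bisect i B s fuel lo hi) in ~~ raised m && raised m.+1.
Proof.
move=> raised; elim: fuel lo hi => [|fuel IH] lo hi rlo rhi le_lohi.
  have /eqP hiE : hi == lo.+1.
    have : hi != lo by apply: contraNneq rlo => <-.
    by move: le_lohi; rewrite expn0; lia.
  by rewrite /= rlo -hiE.
rewrite /= -/(raised _); move: le_lohi; rewrite expnS => le_lohi.
by case: ifPn => rmid; apply: IH => //; lia.
Qed.

Definition first_raising (i : 'I_k) (B : {set V}) (s : seq V) :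
    oracle_alg V k (option V) :=
  Query i (B :|: [set x in s]) (fun r =>
    if #|B| < r then
      bind (bisect i B s (up_log 2 (size s)) 0 (size s))
           (fun m => Return V k (onth s m))
    else Return V k None).

Lemma query_count_first_raising o i B s :
  query_count o (first_raising i B s) <= (up_log 2 (size s)).+1.
Proof.
rewrite /=; case: ifP => //= _.
by rewrite query_count_bind /= query_count_bisect addn0.
Qed.

Variant first_raising_spec (o : 'I_k -> {set V} -> nat) i (B : {set V})
    (s : seq V) :
    option V -> Prop :=
| RaisingNone of o i (B :|: [set x in s]) <= #|B| :
    first_raising_spec o i B s None
| RaisingSome s1 u s2 of s = s1 ++ u :: s2
    & o i (B :|: [set x in s1]) <= #|B|
    & #|B| < o i (B :|: [set x in rcons s1 u]) :
    first_raising_spec o i B s (Some u).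

Lemma first_raisingP o i (B : {set V}) s : o i B <= #|B| ->
  first_raising_spec o i B s (output o (first_raising i B s)).
Proof.
move=> leB /=; case: ifPn => [rs|]; last by rewrite -leqNgt => ?; constructor.
rewrite output_bind /=.
have := @bisectP o i B s (up_log 2 (size s)) 0 (size s).
rewrite /= take0 take_size rs; set m := output _ _.
have -> : [set x in [::]] = set0 :> {set V} by apply/setP => x; rewrite !inE.
rewrite setU0 -leqNgt leB add0n up_logP // => /(_ isT isT isT)/andP[rm rm1].
have lt_m : m < size s.
  by rewrite ltnNge; apply: contra rm => le_m; rewrite take_oversize.
have [u su] : exists u, onth s m = Some u.
  by move: lt_m; rewrite -onthTE; case: onth => // u _; exists u.
have nu : nth u s m = u by exact: onth_nth su.
rewrite su; apply: (@RaisingSome _ _ _ _ (take m s) u (drop m.+1 s)).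
- by rewrite -{1}nu -drop_nth // cat_take_drop.
- by rewrite leqNgt.
- by rewrite -nu -take_nth.
Qed.

End Oracle.

(** * The auction and its query count *)

Section Auction.
Variables (V : finType) (k L : nat).

(** A matroid becomes idle when no element of level below [L] raises the rank of its held set, and
    active again when it loses an element. *)
Record state := State {
  level : V -> nat;
  owner : V -> option 'I_k;
  idle : {set 'I_k}
}.

Definition held st i : {set V} := [set v | owner st v == Some i].

(* What [i] would pay: an element held by another matroid or by none goes up by 1
   when [i] takes it. *)
Definition price st i v := level st v + (owner st v != Some i).

Definition cheap st i j : {set V} := [set v | price st i v < j].

Definition unsaturated st : {set V} := [set v | level st v < L].

Definition candidates st : seq V :=
  sort (relpre (level st) leq) (enum (unsaturated st)).

Definition grab st i u := State
  (fun v => level st v + (v == u))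
  (fun v => if v == u then Some i else owner st v)
  [set i' in idle st | owner st u != Some i'].

Definition retire st i := State (level st) (owner st) (i |: idle st).

Fixpoint auction N st : oracle_alg V k state :=
  if N isn't N'.+1 then Return V k st else
  if [pick i | i \notin idle st] is Some i then
    bind (first_raising i (held st i) (candidates st)) (fun a =>
      auction N' (if a is Some u then grab st i u else retire st i))
  else Return V k st.

Lemma auctionS N st : auction N.+1 st =
  if [pick i | i \notin idle st] is Some i then
    bind (first_raising i (held st i) (candidates st)) (fun a =>
      auction N (if a is Some u then grab st i u else retire st i))
  else Return V k st.
Proof. by []. Qed.

Definition start := State (fun=> 0) (fun=> None) set0.

Lemma query_count_auction o N st :
  query_count o (auction N st) <= N * (up_log 2 #|V|).+1.
Proof.
elim: N st => [|N IH] st; first by [].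
rewrite auctionS; case: pickP => [i _|//].
rewrite query_count_bind mulSn leq_add //.
apply: leq_trans (query_count_first_raising _ _ _ _) _.
by rewrite ltnS leq_up_log // size_sort -cardE max_card.
Qed.

(** * Invariant and termination of the auction *)

Variable M : 'I_k -> matroid V.

(* [valid_free] says that [held st i] extends to a cheapest basis of [M i] with
   respect to [price st i]. *)
Record valid st : Prop := Valid {
  valid_free : forall i j,
    free_over (M i) (cheap st i j) (held st i :\: cheap st i j);
  valid_level : forall v, level st v <= L;
  valid_owner : forall v, owner st v = None -> level st v = 0;
  valid_idle : forall i, i \in idle st ->
    rank (M i) (held st i :|: unsaturated st) <= #|held st i|
}.

(* A take lowers the sum by 1 but may make the previous holder active again:
   hence the factor 2. *)
Definition potential st := (\sum_v (L - level st v)).*2 + #|~: idle st|.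

Lemma valid_start : valid start.
Proof.
split=> // [i j|i]; last by rewrite inE.
have -> : held start i = set0 by apply/setP => v; rewrite !inE.
by rewrite set0D /free_over setU0 cards0 addn0.
Qed.

(** At threshold 0 the cheap set is empty, and being free over the empty set is independence. *)
Lemma rank_held st i : valid st -> rank (M i) (held st i) = #|held st i|.
Proof.
move=> /valid_free/(_ i 0)/eqP.
have -> : cheap st i 0 = set0 by apply/setP => v; rewrite !inE.
by rewrite setD0 set0U => ->; have := rank_leq_card (M i) set0;
  rewrite cards0; lia.
Qed.

Lemma mem_candidates st v : (v \in candidates st) = (level st v < L).
Proof. by rewrite mem_sort mem_enum inE. Qed.

Lemma level_prefix st s1 u s2 v : candidates st = s1 ++ u :: s2 ->
  level st u < L -> level st v < level st u -> v \in s1.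
Proof.
move=> sE lt_uL lt_vu; have: v \in candidates st.
  by rewrite mem_candidates; apply: ltn_trans lt_uL.
have: sorted (relpre (level st) leq) (candidates st).
  by apply: sort_sorted => x y; apply: leq_total.
rewrite sE sorted_pairwise; last by move=> x y z; apply: leq_trans.
rewrite pairwise_cat /= => /and4P[_ _ /allP le_u _].
rewrite mem_cat inE => /or3P[//|/eqP vu|/le_u /=]; last lia.
by rewrite vu ltnn in lt_vu.
Qed.

Lemma valid_retire st i : valid st ->
  rank (M i) (held st i :|: unsaturated st) <= #|held st i| ->
  valid (retire st i).
Proof.
by case=> *; split=> //= i'; rewrite !inE => /orP[/eqP->|] //; auto.
Qed.

Lemma potential_retire st i :
  i \notin idle st -> potential (retire st i) < potential st.
Proof.
move=> ii; rewrite /potential ltn_add2l.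
apply: proper_card; rewrite setCU properE subsetIr /=.
by apply/subsetPn; exists i; rewrite !inE // eqxx.
Qed.

Lemma potential_grab st i u :
  level st u < L -> potential (grab st i u) < potential st.
Proof.
move=> lt_uL; rewrite /potential (bigD1 u) //= [in X in _ < X](bigD1 u) //=.
rewrite eqxx addn1 (eq_bigr (fun v => L - level st v)); last first.
  by move=> v /negPf->; rewrite addn0.
suff: #|~: [set i' in idle st | owner st u != Some i']| <= #|~: idle st|.+1.
  by move: #|_| #|_| (\sum_(_ | _) _) => a b c; rewrite -!addnn; lia.
case: (owner st u) => [i0|]; last first.
  by rewrite ltnW // ltnS; apply/subset_leq_card/subsetP => x;
     rewrite !inE andbT.
apply: (@leq_trans #|i0 |: ~: idle st|); last by rewrite cardsU1; case: (_ \in _).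
apply/subset_leq_card/subsetP => x; rewrite !inE negb_and negbK orbC.
by rewrite ?(inj_eq Some_inj) eq_sym.
Qed.

Lemma valid_grab st i u : valid st -> i \notin idle st -> level st u < L ->
  rank (M i) (held st i :|: [set v | level st v < level st u])
    <= #|held st i| ->
  #|held st i| < rank (M i) (u |: held st i) ->
  valid (grab st i u).
Proof.
move=> vst ii lt_uL le_low gt_u; set st' := grab st i u.
have rS := rank_held i vst.
have uS : u \notin held st i.
  by apply: contraTN gt_u => uS; rewrite (setUidPr _) ?sub1set // rS ltnn.
have ou : owner st u == Some i = false by move: uS; rewrite inE => /negPf.
have heldi : held st' i = u |: held st i.
  by apply/setP => v; rewrite !inE /=; case: (v == u); rewrite ?eqxx.
have heldN i' : i' != i -> held st' i' = held st i' :\ u.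
  move=> ne; apply/setP => v; rewrite !inE /=; case: (eqVneq v u) => //= _.
  by rewrite ?(inj_eq Some_inj) eq_sym (negPf ne).
split=> /=.
(* For another matroid the price of [u] rises and the held set can only shrink, so [free_overS]
   applies. *)
- move=> i' j; have [->{i'}|ne] := eqVneq i' i; last first.
    apply: free_overS (valid_free vst i' j).
      apply/subsetP => v; rewrite !inE /price /=.
      case: (eqVneq v u) => [->|_]; last by rewrite addn0.
      by rewrite ?(inj_eq Some_inj) eq_sym ne; case: (_ != _); lia.
    apply/subsetP => v; rewrite heldN // !inE /price /=.
    by case: (eqVneq v u) => _ /=; rewrite ?andbF ?addn0.
  (* For [i] the price of [u] stays [level st u + 1]: first because [u] is not held, then because
     its level went up. *)
  have -> : cheap st' i j = cheap st i j.
    apply/setP => v; rewrite !inE /price /=.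
    by case: (eqVneq v u) => [->|_]; rewrite ?eqxx ?ou /= !addn0 ?addn1.
  have fS := valid_free vst i j.
  rewrite heldi setDUl; have [uX|uX] := boolP (u \in cheap st i j).
    rewrite (_ : [set u] :\: _ = set0) ?set0U //.
    by apply/eqP; rewrite setD_eq0 sub1set.
  rewrite (_ : [set u] :\: _ = [set u]); last first.
    by apply/setDidPl; rewrite disjoints1.
  have uT : u \notin held st i :\: cheap st i j by rewrite inE negb_and uS orbT.
  (* A cheap element that is not held has a smaller level than [u], so by [le_low] the cheap set
     adds nothing to the span of the held set. As [u] does, it raises the rank here by exactly 1. *)
  have sX : cheap st i j \subset
      held st i :|: [set v | level st v < level st u].
    apply/subsetP => v; move: uX; rewrite !inE /price ou /=.
    by case: (_ == _) => //=; lia.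
  have sS : held st i \subset cheap st i j :|: (held st i :\: cheap st i j).
    by apply/subsetP => v vS; rewrite in_setU in_setD vS andbT orbN.
  have le1 : rank (M i) (u |: held st i) <=
      rank (M i) (cheap st i j :|: (u |: (held st i :\: cheap st i j))).
    by apply: rankS; rewrite setUCA setUS.
  have le2 : rank (M i) (cheap st i j :|: (held st i :\: cheap st i j)) <=
      rank (M i) (held st i :|: [set v | level st v < level st u]).
    apply: rankS; rewrite subUset sX /=.
    by apply: subset_trans (subsetDl _ _) (subsetUl _ _).
  apply/eqP/anti_leq; rewrite rankU_leq /= cardsU1 uT.
  by move/eqP: fS; lia.
- move=> v; case: (eqVneq v u) => [->|_]; first by rewrite addn1.
  by rewrite addn0 (valid_level vst).
- by move=> v; case: (eqVneq v u) => // _ /(valid_owner vst) ->.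
(* A matroid that stays idle did not hold [u], so its held set is unchanged while the unsaturated
   set can only shrink. *)
- move=> i'; rewrite inE => /andP[i'i ou'].
  have ne : i' != i by apply: contraNneq ii => <-.
  rewrite heldN // (setDidPl _); last by rewrite disjoint_sym disjoints1 inE.
  apply: leq_trans (valid_idle vst i'i); apply: rankS; apply: setUS.
  by apply/subsetP => v; rewrite !inE /=; lia.
Qed.

(** Every turn, a take or a retirement, lowers the potential; at potential 0 no matroid is
    active. *)
Lemma auctionP N st : valid st -> potential st <= N ->
  let st' := output (rank_oracle M) (auction N st) in
  valid st' /\ idle st' = setT.
Proof.
elim: N st => [|N IH] st vst leN.
  split=> //; apply: setC_inj; rewrite setCT; apply/eqP.
  by rewrite -cards_eq0 -leqn0; apply: leq_trans leN; apply: leq_addl.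
rewrite auctionS; case: pickP => [i ii|all_idle]; last first.
  by split=> //; apply/setP => i; rewrite inE; have /negbFE := all_idle i.
rewrite output_bind.
case: first_raisingP => [|leS|s1 u s2 sE leS gtS].
- by rewrite /rank_oracle rank_held.
- apply: IH; last by have := potential_retire ii; lia.
  apply: valid_retire => //; move: leS; congr (rank _ (_ :|: _) <= _).
  by apply/setP => v; rewrite inE mem_candidates inE.
have lt_uL : level st u < L.
  by rewrite -mem_candidates sE mem_cat mem_head orbT.
apply: IH; last by have := potential_grab i lt_uL; lia.
apply: valid_grab => //.
  apply: leq_trans leS; apply: rankS; apply: setUS.
  by apply/subsetP => v; rewrite !inE; apply: level_prefix sE lt_uL.
(* By submodularity, [u] raises the rank of the held set alone because it raises that of the held
   set with [s1]. *)
have := rank_submod (M i) (held st i :|: [set x in s1]) (u |: held st i).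
have le1 : rank (M i) (held st i :|: [set x in rcons s1 u]) <=
    rank (M i) (held st i :|: [set x in s1] :|: (u |: held st i)).
  apply: rankS; apply/subsetP => x; rewrite !inE mem_rcons inE.
  by case/or3P=> ->; rewrite ?orbT.
have le2 : rank (M i) (held st i) <=
    rank (M i) ((held st i :|: [set x in s1]) :&: (u |: held st i)).
  by apply: rankS; rewrite subsetI subsetUl subsetUr.
rewrite -(rank_held i vst) in leS gtS *.
by move: leS gtS; rewrite /rank_oracle; lia.
Qed.

(** * Near-optimality of the final allocation *)

Definition sold st : {set V} := \bigcup_i held st i.

Lemma held_disjoint st i j : i != j -> [disjoint held st i & held st j].
Proof.
move=> ne; rewrite -setI_eq0; apply/eqP/setP => v; rewrite !inE.
apply: contraNF ne => /andP[/eqP-> /eqP[->]]; exact: eqxx.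
Qed.

Lemma partitionable_sold st : valid st -> partitionable M (sold st).
Proof.
move=> vst; apply/existsP; exists [ffun i => held st i]; apply/and3P; split.
- by apply/forallP => i; rewrite ffunE indep_rank // rank_held.
- apply/forallP => i; apply/forallP => j; rewrite !ffunE.
  by apply/implyP; apply: held_disjoint.
- by apply/eqP; apply: eq_bigr => i _; rewrite ffunE.
Qed.

Lemma level_unsold st v : valid st -> v \notin sold st -> level st v = 0.
Proof.
move=> vst; apply: contraNeq => lv; case ov: (owner st v) => [i|].
  by apply/bigcupP; exists i; rewrite ?inE ?ov.
by rewrite (valid_owner vst ov) in lv.
Qed.

(** For [j <= L] every cheap element is held or unsaturated, so idleness bounds the rank of the
    cheap and held elements together by [#|held st i|]. Subtracting the held part that is free over
    the cheap set gives the bound. *)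
Lemma rank_cheap st i j : valid st -> i \in idle st -> j <= L ->
  rank (M i) (cheap st i j) <= #|held st i :&: cheap st i j|.
Proof.
move=> vst ii le_jL; have /eqP fX := valid_free vst i j.
have := cardsID (cheap st i j) (held st i).
suff: rank (M i) (cheap st i j :|: held st i :\: cheap st i j)
    <= #|held st i| by lia.
apply: leq_trans (valid_idle vst ii); apply: rankS; apply/subsetP => v.
by rewrite !inE /price; case: (_ == _) => //=; lia.
Qed.

(** Layer-cake formula: [L - p v] counts the [j < L] with [p v <= j], and truncation gives 0 for
    prices above [L]. *)
Lemma sum_discount (A : {set V}) (p : V -> nat) :
  \sum_(v in A) (L - p v) = \sum_(j < L) #|A :&: [set v | p v < j.+1]|.
Proof.
have layers m : L - m = \sum_(j < L) (m < j.+1).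
  by elim: (L) => [|l IH]; [rewrite big_ord0 | rewrite big_ord_recr /= -IH; lia].
rewrite (eq_bigr _ (fun v _ => layers (p v))) exchange_big /=.
apply: eq_bigr => j _; rewrite -sum1_card big_mkcond [RHS]big_mkcond /=.
by apply: eq_bigr => v _; rewrite !inE; case: (v \in A); case: (_ < _).
Qed.

(** Greedy optimality, threshold by threshold: [O] meets a cheap set in at most its rank, which
    [held st i] attains. *)
Lemma held_demanded st i O : valid st -> i \in idle st -> O \in indep (M i) ->
  \sum_(v in O) (L - price st i v) <= \sum_(v in held st i) (L - level st v).
Proof.
move=> vst ii Oi.
have -> : \sum_(v in held st i) (L - level st v)
    = \sum_(v in held st i) (L - price st i v).
  by apply: eq_bigr => v; rewrite inE /price => ->; rewrite addn0.
rewrite !sum_discount; apply: leq_sum => j _.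
apply: leq_trans (rank_cheap vst ii (ltn_ord j)).
by apply: leq_rank (subsetIr _ _) _; apply: indep_subset Oi; apply: subsetIl.
Qed.

Lemma sold_near_optimal st O : valid st -> idle st = setT ->
  partitionable M O -> L * #|O| <= L * #|sold st| + #|O|.
Proof.
move=> vst idleT /existsP[P /and3P[/forallP Pi /forallP Pd /eqP <-]].
set U := \bigcup_i P i.
have dP i j : i != j -> [disjoint P i & P j].
  by move=> ne; have /forallP/(_ j)/implyP := Pd i; apply.
(* Since a price is at most the level plus 1, [L <= (L - price) + (level + 1)] holds even with
   truncated subtraction. *)
have demand : \sum_(v in U) L
    <= \sum_(v in sold st) (L - level st v) + \sum_(v in U) (level st v).+1.
  rewrite !(partition_disjoint_bigcup _ _ dP).
  rewrite (partition_disjoint_bigcup _ _ (@held_disjoint st)) -big_split /=.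
  apply: leq_sum => i _.
  have ii : i \in idle st by rewrite idleT inE.
  apply: leq_trans (leq_add (held_demanded vst ii (Pi i)) (leqnn _)).
  rewrite -big_split /=; apply: leq_sum => v _.
  by rewrite /price; case: (_ != _); lia.
(* Unsold elements have level 0, so the right-hand side is the sum of all levels. *)
have sum_level : \sum_(v in U) level st v <= \sum_(v in sold st) level st v.
  rewrite [leqRHS](_ : _ = \sum_v level st v); last first.
    rewrite [RHS](bigID (mem (sold st))) /= [X in _ + X]big1 ?addn0 // => v.
    exact: level_unsold.
  by rewrite [leqRHS](bigID (mem U)) /= leq_addr.
have sum_sold : \sum_(v in sold st) (L - level st v)
    + \sum_(v in sold st) level st v = L * #|sold st|.
  rewrite -big_split /= (eq_bigr (fun=> L)) ?sum_nat_const 1?mulnC // => v _.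
  by rewrite subnK // valid_level.
have sum_succ : \sum_(v in U) (level st v).+1
    = \sum_(v in U) level st v + #|U|.
  rewrite -sum1_card -big_split /=; apply: eq_bigr => v _; exact/esym/addn1.
by move: demand; rewrite sum_nat_const sum_succ mulnC; lia.
Qed.

(** The fuel is the potential of [start]. *)
Definition auction_alg : oracle_alg V k {set V} :=
  bind (auction ((#|V| * L).*2 + k) start) (fun st => Return V k (sold st)).

Lemma auction_algP : let S := output (rank_oracle M) auction_alg in
  partitionable M S
  /\ L * max_partitionable M <= L * #|S| + max_partitionable M.
Proof.
have pot0 : potential start <= (#|V| * L).*2 + k.
  rewrite /potential /= setC0 cardsT card_ord leq_add2r.
  by rewrite subn0 sum_nat_const.
have [vst idleT] := auctionP valid_start pot0.
rewrite /= output_bind /=; set st := output _ _ in vst idleT *.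
split; first exact: partitionable_sold.
rewrite /max_partitionable.
rewrite (bigmax_eq_arg (sold start)); last exact: partitionable_sold valid_start.
case: arg_maxnP => [|O pO _]; first exact: partitionable_sold valid_start.
exact: sold_near_optimal.
Qed.

End Auction.

(** * Query bound and choice of [L] *)

Lemma query_count_auction_alg (V : finType) (k L : nat) o :
  query_count o (auction_alg V k L)
    <= ((#|V| * L).*2 + k) * (up_log 2 #|V|).+1.
Proof. by rewrite query_count_bind addn0 query_count_auction. Qed.


Import Order.TTheory GRing.Theory Num.Theory.
Local Open Scope ring_scope.

Theorem theorem7 (R : realType) :
  exists C : R, 0 < C /\
    forall eps : R, 0 < eps ->
    exists alg : forall (V : finType) (k : nat), oracle_alg V k {set V},
    forall (V : finType) (k : nat) (M : 'I_k -> matroid V),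
      let S := output (rank_oracle M) (alg V k) in
      [/\ partitionable M S,
          (1 - eps) * (max_partitionable M)%:R <= #|S|%:R
        & (2 <= #|V|)%N ->
          (query_count (rank_oracle M) (alg V k))%:R
            <= C * ((#|V| + k)%:R * eps^-1 * ln (#|V|%:R : R))].
Proof.
have ln2_gt0 : 0 < ln (2 : R) by rewrite ln_gt0 // ltr1n.
(* 12 is the product of the factor 4 in [turns_le] and the factor 3 in [up_log_le]; [ln 2] converts
   the binary logarithm. *)
exists (12 / ln 2); split; first by rewrite divr_gt0.
(* For [eps >= 1] the required size is at most 0, and the empty allocation is returned without a
   query. *)
move=> eps eps_gt0; have [eps_ge1|eps_lt1] := leP 1 eps.
  exists (fun V k => Return V k (sold (start V k))) => V k M /=; split.
  - exact: (partitionable_sold (valid_start 0 M)).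
  - by rewrite (le_trans (mulr_le0_ge0 _ _)) ?subr_le0.
  - move=> n_ge2; rewrite !mulr_ge0 ?invr_ge0 ?(ltW ln2_gt0) ?(ltW eps_gt0) //.
    by rewrite ln_ge0 // ler1n ltnW.
(* This gives [eps^-1 < L <= 2 * eps^-1], the upper bound because [eps^-1 > 1]. *)
pose L := (Num.trunc eps^-1).+1.
have L_gt : eps^-1 < L%:R by apply: truncnS_gt.
have eps1_gt1 : 1 < eps^-1 by rewrite invf_gt1.
have L_le : L%:R <= 2 * eps^-1.
  have : (Num.trunc eps^-1)%:R <= eps^-1 by rewrite truncn_le ltW ?invr_gt0.
  by rewrite /L -addn1 natrD; lra.
exists (fun V k => auction_alg V k L) => V k M S.
have [pS near_opt] := auction_algP L M; split=> //.
  have L_gt0 : 0 < L%:R :> R by rewrite ltr0n.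
  have epsL : 1 <= eps * L%:R by rewrite -ler_pdivrMl // mulr1 ltW.
  rewrite -(ler_pM2l L_gt0); move: near_opt.
  rewrite -(ler_nat R) natrD !natrM -/S => near_opt.
  (* The additive error in [near_opt], one optimum, is at most [eps * L] optima; the goal has been
     scaled by [L]. *)
  have := ler_wpM2r (ler0n R (max_partitionable M)) epsL.
  by move: near_opt; lra.
move=> n_ge2; have := query_count_auction_alg L (rank_oracle M).
rewrite -(ler_nat R) => /le_trans; apply.
rewrite natrM -addnn !natrD natrM.
have ln_n : ln (2 : R) <= ln #|V|%:R.
  by rewrite ler_ln ?posrE ?ltr0n ?ler_nat //; apply: leq_trans n_ge2.
(* The rounded-up logarithm minus 1 is at most the binary logarithm of [#|V|], and the remaining 2
   is at most twice it since [#|V| >= 2]. *)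
have up_log_le : (up_log 2 #|V|).+1%:R <= 3 * (ln #|V|%:R / ln 2) :> R.
  have lt_n : ((up_log 2 #|V|).-1)%:R <= ln #|V|%:R / ln 2 :> R.
    rewrite ler_pdivlMr // mulr_natl -lnXn // ler_ln ?posrE ?exprn_gt0 //.
      by rewrite -natrX ler_nat ltnW // up_log_gtn.
    by rewrite ltr0n; apply: leq_trans n_ge2.
  have ge1 : 1 <= ln #|V|%:R / ln 2 :> R by rewrite ler_pdivlMr // mul1r.
  have -> : (up_log 2 #|V|).+1 = ((up_log 2 #|V|).-1 + 2)%N.
    by rewrite addn2 prednK // up_log_gt0.
  by rewrite natrD; lra.
have turns_le : #|V|%:R * L%:R + #|V|%:R * L%:R + k%:R
    <= 4 * ((#|V|%:R + k%:R) * eps^-1) :> R.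
  have nL := ler_wpM2l (ler0n R #|V|) L_le.
  have kL := ler_wpM2l (ler0n R k) (ltW eps1_gt1).
  have k0 := ler0n R k.
  by move: nL kL; rewrite mulr1; nra.
apply: le_trans (ler_pM _ _ turns_le up_log_le) _ => //.
  by rewrite -?natrM -?natrD.
rewrite le_eqVlt; apply/orP; left; apply/eqP.
by field; rewrite (gt_eqF ln2_gt0) (gt_eqF eps_gt0).
Qed.
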